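(* Let $\mu,\nu$ be Borel probability measures on $\mathbb{R}$ with compact support and without atoms. Let $\gamma,\bar\gamma\in\mathcal{O}_\infty(\mu,\nu)$ be optimal transport plans and assume that $\bar\gamma$ is $\infty$-cyclically monotone. Then $$M_{\bar\gamma}^+\subseteq M_\gamma^+\quad\text{and}\quad M_{\bar\gamma}^-\subseteq M_\gamma^-.$$ In other words, there are two compact sets $M^+$ and $M^-$ such that, for any optimal plan $\gamma\in\mathcal{O}_\infty(\mu,\nu)$, $$M^+\subseteq M_\gamma^+\quad\text{and}\quad M^-\subseteq M_\gamma^-,$$ with equality if $\gamma$ is $\infty$-cyclically monotone (in particular, all the $\infty$-cyclically monotone plans have the same set of maximal displacements).
   Context: $\Pi(\mu,\nu)$ is the set of positive Borel measures on $\mathbb{R}\times\mathbb{R}$ with first marginal $\mu$ and second marginal $\nu$ (transport plans). $\lambda_C:=\mathcal{W}_\infty(\mu,\nu):=\min_{\gamma\in\Pi(\mu,\nu)}\ \gamma\text{-ess sup}\,|x-y|$, and $\mathcal{O}_\infty(\mu,\nu)$ is the set of minimizers (optimal transport plans). $\operatorname{spt}$ denotes the support of a measure. A plan $\gamma\in\Pi(\mu,\nu)$ is $\infty$-cyclically monotone if for all $n\in\mathbb{N}$ and $(x_0,y_0),\dots,(x_n,y_n)\in\operatorname{spt}(\gamma)$, $\max_{0\le i\le n}|x_i-y_i|\le\max_{0\le i\le n}|x_i-y_{i+1}|$, where $y_{n+1}=y_0$. It is known that at least one such plan exists when $\mu,\nu$ are compactly supported, and that such plans belong to $\mathcal{O}_\infty(\mu,\nu)$.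 For $\gamma\in\mathcal{O}_\infty(\mu,\nu)$: $M_\gamma^+:=\{x : (x,x+\lambda_C)\in\operatorname{spt}(\gamma)\}$, $M_\gamma^-:=\{x : (x,x-\lambda_C)\in\operatorname{spt}(\gamma)\}$, and $M_\gamma:=M_\gamma^+\cup M_\gamma^-$ is the maximal displacement set of $\gamma$. *)

(* Defs.v *)
From HB Require Import structures.
From mathcomp Require Import all_boot all_order all_algebra.
From mathcomp Require Import all_classical all_reals all_analysis.
From mathcomp Require Import ess_sup_inf.

Set Implicit Arguments.
Unset Strict Implicit.
Unset Printing Implicit Defensive.

Import Order.TTheory GRing.Theory Num.Theory.
Import numFieldNormedType.Exports.

Local Open Scope classical_set_scope.
Local Open Scope ring_scope.

(** The sigma-algebra on [R * R] is the product of the Borel sigma-algebras,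
    i.e. the Borel sigma-algebra of the plane. *)
Local Notation plan R := {measure set (R * R)%type -> \bar R}.

(** [mu] is a bare set function so that the same definition applies to measures
    on [R] and on [R * R]; it is only evaluated on open sets. *)
Definition spt (R : realType) (T : topologicalType) (mu : set T -> \bar R) :
    set T :=
  [set x | forall U : set T, open U -> U x -> (0 < mu U)%E].

(** For a Borel measure on the line with finite mass this is non-atomicity. *)
Definition atomless (R : realType) (mu : probability R R) : Prop :=
  forall x : R, mu [set x] = 0%E.

Section transport.
Context {R : realType}.
Variables mu nu : probability R R.
Implicit Type gamma : plan R.

Definition transport_plan : set (plan R) :=
  [set gamma : plan R | forall A : set R, measurable A ->
     pushforward gamma fst A = mu A /\ pushforward gamma snd A = nu A].

Definition max_cost gamma : \bar R :=
  ess_sup gamma (fun p => `|p.1 - p.2|%:E).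

(** The minimum in the definition of the distance is taken as an infimum; it is
    attained exactly when [optimal_plan] is nonempty. *)
Definition Winfty : \bar R :=
  ereal_inf [set max_cost gamma | gamma in transport_plan].

Definition optimal_plan : set (plan R) :=
  [set gamma : plan R | transport_plan gamma /\ max_cost gamma = Winfty].

(** [ordS i] is [i + 1] modulo [n + 1], so that [y_(n+1) = y_0]. The maxima are
    over nonempty families of nonnegative reals, hence the neutral value [0]. *)
Definition infty_cyclically_monotone : set (plan R) :=
  [set gamma : plan R | transport_plan gamma /\
     forall (n : nat) (p : 'I_n.+1 -> R * R), (forall i, spt gamma (p i)) ->
       \big[Num.max/0]_(i < n.+1) `|(p i).1 - (p i).2| <=
       \big[Num.max/0]_(i < n.+1) `|(p i).1 - (p (ordS i)).2|].

(** [Winfty] is finite as soon as [mu] and [nu] have compact support, since then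
    [mu \x nu] is a plan with bounded cost. *)
Definition lambdaC : R := fine Winfty.

Definition Mplus gamma : set R := [set x | spt gamma (x, x + lambdaC)].
Definition Mminus gamma : set R := [set x | spt gamma (x, x - lambdaC)].
Definition Mset gamma : set R := Mplus gamma `|` Mminus gamma.

End transport.

(* Main.v *)
(** Let [L] be the largest displacement of an infinity-cyclically monotone plan
    [g], attained at [(x, y)] in its support, say with [y = x + L]. A support
    point [(x', y')] with [x < x'] and [y' < y] is impossible: exchanging the
    targets would make both displacements strictly shorter than [L]. Hence
    [nu (-oo, y) <= mu (-oo, x)], while any plan [h] of cost at most [L] sends
    [(-oo, x)] into [(-oo, y]]. So the two masses are equal, [h] does not charge
    the quadrant [{x' > x, y' < y}] either, and the mass that [mu] has just to
    the right of [x], or [nu] just to the left of [y], is forced by [h] into any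
    box around [(x, y)]. Thus [(x, y)] is in the support of [h]. Applied to
    a hypothetical [h] of cost smaller than [L], this also shows that [g] is
    optimal. *)
Require Import Defs.
From mathcomp Require Import all_boot all_order all_algebra.
From mathcomp Require Import all_classical all_reals all_analysis.
From mathcomp Require Import measurable_realfun ess_sup_inf lra.
Import Order.TTheory GRing.Theory Num.Theory.
Import numFieldNormedType.Exports.
Local Open Scope classical_set_scope.
Local Open Scope ring_scope.

(** * Open sets of the plane and supports of measures *)

Section plane.
Context {R : realType}.
Implicit Types (U : set (R * R)) (g : {measure set (R * R)%type -> \bar R}).

(** A countable base of the plane: it makes open sets measurable for the product sigma-algebra. *)
Definition ratball (q : rat * rat * rat) : set (R * R) :=
  ball (ratr q.1.1 : R, ratr q.1.2 : R) (ratr q.2 : R).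

Lemma open_ratball U (p : R * R) : open U -> U p ->
  exists q, ratball q p /\ ratball q `<=` U.
Proof.
move=> oU Up; have : nbhs p U by rewrite nbhsE /=; exists U.
move=> /nbhs_ballP[e /= e0 eU].
(* The centre is only near [p], so the radius stays below [e / 2] to keep the ball within [e] of
   [p]. *)
have [c /[!in_itv]/= /andP[c0 ce]] := @rat_in_itvoo R 0 (e / 2) ltac:(lra).
have near_rat (x : R) : exists q : rat, ball (ratr q : R) (ratr c) x.
  have [q /[!in_itv]/= /andP[q1 q2]] :=
    @rat_in_itvoo R (x - ratr c) (x + ratr c) ltac:(lra).
  by exists q; rewrite /ball /= ltr_norml; apply/andP; split; lra.
have [qx hx] := near_rat p.1; have [qy hy] := near_rat p.2.
exists (qx, qy, c); split => // z hz; apply: eU.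
apply: (@le_ball _ _ _ (ratr c + ratr c)); first lra.
by apply: (ball_triangle _ hz); apply: ball_sym; split.
Qed.

Lemma open_bigcup_ratball U : open U ->
  U = \bigcup_n (if @unpickle (rat * rat * rat)%type n is Some q
                 then if `[< ratball q `<=` U >] then ratball q else set0
                 else set0).
Proof.
move=> oU; apply/seteqP; split => [p Up|p [n _]].
  have [q [qp qU]] := open_ratball _ _ oU Up.
  by exists (pickle q); [exact: I|rewrite pickleK asboolT].
by case: unpickle => [q|//]; case: asboolP => // qU /qU.
Qed.

Lemma measurable_ball_plane (p : R * R) (r : R) :
  measurable (ball p r : set (R * R)).
Proof.
rewrite (_ : ball p r = ball p.1 r `*` ball p.2 r)//.
by apply: measurableX; apply: open_measurable; exact: ball_open.
Qed.

Lemma open_measurable_plane U : open U -> measurable U.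
Proof.
move=> /open_bigcup_ratball ->; apply: bigcupT_measurable => n.
case: unpickle => [q|]; last exact: measurable0.
by case: ifP => _; [exact: measurable_ball_plane|exact: measurable0].
Qed.

(** A point outside the support has a null open neighbourhood, hence lies in a null rational ball,
    and these are countably many. *)
Lemma negligible_sptC g : g.-negligible (~` spt g).
Proof.
rewrite [X in _.-negligible X](_ : _ =
    \bigcup_n (if @unpickle (rat * rat * rat)%type n is Some q
               then if g (ratball q) == 0%E then ratball q else set0
               else set0)); last first.
  apply/seteqP; split => [p /= /existsNP[U /not_implyP[oU /not_implyP[Up]]]|].
    move=> /negP; rewrite lt0e measure_ge0 andbT negbK => /eqP gU.
    have [q [qp qU]] := open_ratball _ _ oU Up.
    exists (pickle q); first exact: I.
    rewrite pickleK ifT//.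
    by rewrite -measure_le0 -gU le_measure ?inE//;
      [exact: measurable_ball_plane|exact: open_measurable_plane].
  move=> p [n _]; case: unpickle => [q|//]; case: ifP => // /eqP gq qp sp.
  have := sp _ (ball_open _ _) qp.
  by rewrite gq ltxx.
apply: negligible_bigcup => n; case: unpickle => [q|]; last exact: negligible_set0.
case: ifPn => [/eqP q0|_]; last exact: negligible_set0.
by apply/negligibleP => //; exact: measurable_ball_plane.
Qed.

Lemma closed_spt g : closed (spt g).
Proof.
move=> p clp U oU Up.
have /clp[q [sq Uq]] : nbhs p U by rewrite nbhsE /=; exists U.
exact: sq.
Qed.

Lemma spt_not_negligible g U p : open U -> spt g p -> U p -> ~ g.-negligible U.
Proof.
move=> oU sp Up /(measure_negligible (open_measurable_plane _ oU)) gU.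
by have := sp _ oU Up; rewrite gU ltxx.
Qed.

End plane.

(** * Null quadrants of two measures with equal marginals *)

Section quadrants.
Context d (T : measurableType d) (R : realType).
(** The coordinates [a] and [b] are abstract so that one argument serves displacements to the right
    ([fst], [snd]) and to the left ([snd], [fst]). *)
Variables (g h : {measure set T -> \bar R}) (a b : T -> R).
Hypotheses (ma : measurable_fun setT a) (mb : measurable_fun setT b).
Hypothesis lawa : forall A, measurable A -> g (a @^-1` A) = h (a @^-1` A).
Hypothesis lawb : forall A, measurable A -> g (b @^-1` A) = h (b @^-1` A).
Hypothesis gfin : (g setT < +oo)%E.

Variables x L : R.
Local Notation y := (x + L).
Hypothesis atom_a : g (a @^-1` [set x]) = 0%E.
Hypothesis atom_b : g (b @^-1` [set y]) = 0%E.
Hypothesis gL : g.-negligible [set p | a p + L < b p].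
Hypothesis hL : h.-negligible [set p | a p + L < b p].
Hypothesis g_no_crossing : g.-negligible [set p | x < a p /\ b p < y].

Let mpre (f : T -> R) (mf : measurable_fun setT f) (A : set R) :
  measurable A -> measurable (f @^-1` A).
Proof. by move=> mA; rewrite -[X in measurable X]setTI; exact: mf. Qed.

Let negl_preimage (f : T -> R) (mf : measurable_fun setT f) (A : set R) :
  (forall A, measurable A -> g (f @^-1` A) = h (f @^-1` A)) ->
  measurable A -> h.-negligible (f @^-1` A) -> g.-negligible (f @^-1` A).
Proof.
move=> law mA /(measure_negligible (mpre _ mf _ mA)) h0.
by apply/negligibleP; [exact: mpre|exact: etrans (law _ mA) h0].
Qed.

Let le_of_negl (m : {measure set T -> \bar R}) (A B N : set T) :
  measurable A -> measurable B -> m.-negligible N -> A `<=` B `|` N ->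
  (m A <= m B)%E.
Proof.
move=> mA mB [M [mM M0 NM]] AB.
rewrite (le_trans _ (_ : (m (B `|` M) <= _)%E))//.
  rewrite le_measure ?inE//; first exact: measurableU.
  by move=> p /AB[?|/NM]; [left|right].
by rewrite measureU0.
Qed.

Let negl_atom (m : {measure set T -> \bar R}) (f : T -> R) (z : R) :
  measurable_fun setT f -> m (f @^-1` [set z]) = 0%E ->
  m.-negligible (f @^-1` [set z]).
Proof. by move=> mf z0; apply/negligibleP => //; exact: mpre. Qed.

(* Both measures give [{b < y}] and [{a < x}] the same mass, and [h] sends all
   of [{a < x}] into [{b <= y}]; nothing is left for the opposite quadrant. *)
Lemma no_crossing_transfer : h.-negligible [set p | x < a p /\ b p < y].
Proof.
pose A := a @^-1` `]-oo, x[; pose B := b @^-1` `]-oo, y[.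
pose C := a @^-1` `]x, +oo[ `&` B.
have mA : measurable A by exact: mpre.
have mB : measurable B by exact: mpre.
have mC : measurable C by apply: measurableI => //; exact: mpre.
rewrite (_ : [set p | _] = C); last first.
  by apply/seteqP; split=> p; rewrite /C /B /= !in_itv /= andbT => -[-> ->].
apply/negligibleP => //.
(* For [g], a point with [b < y] has [a < x], up to the atom at [x] and the null crossings; the
   marginals carry the inequality over to [h]. *)
have BA : (h B <= h A)%E.
  rewrite -lawa// -lawb//.
  have := negligibleU (negl_atom _ _ _ ma atom_a) g_no_crossing.
  move=> /le_of_negl; apply => // p; rewrite /A /B /= !in_itv /= => bp.
  by have [| |] := ltgtP (a p) x; [left|right; right|right; left].
have hAB : (h A <= h (A `&` B))%E.
  have hy : h.-negligible (b @^-1` [set y]).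
    by apply: negl_atom => //; rewrite -lawb.
  have := negligibleU hy hL.
  move=> /le_of_negl; apply => //; first exact: measurableI.
  move=> p; rewrite /A /B /= !in_itv /= => ap.
  by have [bp|bp|] := ltgtP (b p) y; [left|right; right|right; left] => //=;
    rewrite (lt_trans _ bp)// ltrD2r.
have hfin : h (A `&` B) \is a fin_num.
  rewrite ge0_fin_numE//.
  apply: (le_lt_trans (y := h setT)).
    by rewrite le_measure ?inE//; exact: measurableI.
  by rewrite -(preimage_setT a) -lawa.
(* [C] and [A]&[B] are disjoint parts of [B], whose mass is at most that of [A]&[B]; finiteness
   allows cancelling. *)
have : (h C + h (A `&` B) <= 0 + h (A `&` B))%E.
  rewrite add0e -measureU//; last 2 first.
    exact: measurableI.
    apply/seteqP; split => // p; rewrite /C /A /= !in_itv/= andbT.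
    by move=> [[xa _] [/(lt_trans xa)]]; rewrite ltxx.
  apply: le_trans hAB; apply: le_trans BA.
  rewrite le_measure ?inE//; first by apply: measurableU => //; exact: measurableI.
  by move=> p [[]|[]].
by rewrite leeD2rE// measure_le0 => /eqP.
Qed.

(** Under [h], almost every point with [a] just right of [x], or [b] just left of [y], is forced
    into the box by the bound [L] and the absence of crossings. If the box is null, so are these two
    strips, and strips are seen by the marginals shared with [g]. *)
Lemma corner_transfer (r : R) :
  h.-negligible (a @^-1` ball x r `&` b @^-1` ball y r) ->
  g.-negligible (a @^-1` ball x r `&` b @^-1` ball y r).
Proof.
move=> hbox.
have hN := negligibleU (negligibleU hL no_crossing_transfer) hbox.
have ga : g.-negligible (a @^-1` `]x, x + r[).
  apply: negl_preimage => //; apply: negligibleS hN => p /=.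
  rewrite in_itv/= => /andP[xa axr].
  have [bp|bp] := ltP (b p) y; first by left; right.
  have [bp'|bp'] := ltP (a p + L) (b p); first by left; left.
  by right; rewrite /ball/= !ltr_norml; split; apply/andP; split; lra.
have gb : g.-negligible (b @^-1` `]y - r, y[).
  apply: negl_preimage => //; apply: negligibleS hN => p /=.
  rewrite in_itv/= => /andP[yb byr].
  have [ap|ap] := ltP x (a p); first by left; right.
  have [bp'|bp'] := ltP (a p + L) (b p); first by left; left.
  by right; rewrite /ball/= !ltr_norml; split; apply/andP; split; lra.
(* Off the atoms, a box point has [x < a] (strip [ga]), or [a < x] and [b < y] (strip [gb]), or
   [a < x] and [y < b], which violates [gL]. *)
have gN := negligibleU (negligibleU (negl_atom _ _ _ ma atom_a)
  (negl_atom _ _ _ mb atom_b)) (negligibleU (negligibleU gL g_no_crossing)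
  (negligibleU ga gb)).
apply: negligibleS gN => p; rewrite /ball /= !ltr_norml !in_itv/=.
move=> [/andP[a1 a2] /andP[b1 b2]].
have [ax|xa|] := ltgtP (a p) x; last by left; left.
- have [bp|bp|] := ltgtP (b p) y; last by left; right.
  + by right; right; right; apply/andP; split; lra.
  + by right; left; left => /=; lra.
- by right; right; left; apply/andP; split; lra.
Qed.

End quadrants.

(** * Costs of plans and their supports *)

Section transport_plans.
Context {R : realType}.
Implicit Types (mu nu : probability R R)
  (g h : {measure set (R * R)%type -> \bar R}).

Lemma plan_setT {mu nu g} : transport_plan mu nu g -> g setT = 1%E.
Proof.
move=> /(_ setT measurableT)[+ _].
by rewrite /pushforward preimage_setT probability_setT.
Qed.

Lemma max_cost_leP g (L : R) :
  (max_cost g <= L%:E)%E <-> g.-negligible [set p | L < `|p.1 - p.2|].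
Proof.
have setE : [set p : R * R | L < `|p.1 - p.2|] =
    ~` [set p | (`|p.1 - p.2|%:E <= L%:E)%E].
  by apply/seteqP; split => p /=; rewrite lee_fin ltNge => /negP.
by rewrite setE; split => [/ess_supP|gL]; [|apply/ess_supP].
Qed.

Lemma continuous_cost : continuous (fun p : R * R => `|p.1 - p.2|).
Proof.
move=> p; apply: (@continuous_comp _ _ _ (fun p : R * R => p.1 - p.2) Num.norm).
  by apply: continuousB => q; [exact: cvg_fst|exact: cvg_snd].
exact: norm_continuous.
Qed.

(** The cost is continuous, so the set where it exceeds [L] is open, and a null open set misses the
    support. *)
Lemma spt_cost_le g (L : R) p :
  (max_cost g <= L%:E)%E -> spt g p -> `|p.1 - p.2| <= L.
Proof.
move=> /max_cost_leP gL sp; rewrite leNgt; apply/negP => Lp.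
apply: (spt_not_negligible _ _ _ _ sp Lp gL).
apply: (open_comp (f := fun p : R * R => `|p.1 - p.2|) (D := [set t | L < t])).
  by move=> q _; exact: continuous_cost.
exact: open_gt.
Qed.

Lemma max_cost_le_spt g (L : R) :
  (forall p, spt g p -> `|p.1 - p.2| <= L) -> (max_cost g <= L%:E)%E.
Proof.
move=> sL; apply/max_cost_leP; apply: negligibleS (negligible_sptC g) => p /= Lp.
by move=> /sL; rewrite leNgt Lp.
Qed.

Lemma plan_spt_sub {mu nu g} : transport_plan mu nu g ->
  spt g `<=` spt mu `*` spt nu.
Proof.
move=> plang p sp; split => U oU Up.
  rewrite -(plang _ (open_measurable oU)).1; apply: sp => //.
  by apply: open_comp => // q _; exact: cvg_fst.
rewrite -(plang _ (open_measurable oU)).2; apply: sp => //.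
by apply: open_comp => // q _; exact: cvg_snd.
Qed.

Lemma plan_spt_compact {mu nu g} : compact (spt mu) -> compact (spt nu) ->
  transport_plan mu nu g -> compact (spt g).
Proof.
move=> cmu cnu plang; apply: subclosed_compact (plan_spt_sub plang).
  exact: closed_spt.
exact: compact_setX.
Qed.

Lemma plan_spt_neq0 {mu nu g} : transport_plan mu nu g -> spt g !=set0.
Proof.
move=> plang; apply/set0P/eqP => s0.
have := negligible_sptC g; rewrite s0 setC0 => /(measure_negligible measurableT).
by move=> g0; have := plan_setT plang; rewrite g0 => /eqP; rewrite eqe eq_sym oner_eq0.
Qed.

Lemma plan_max_cost {mu nu g} : compact (spt mu) -> compact (spt nu) ->
  transport_plan mu nu g ->
  exists2 p, spt g p & max_cost g = `|p.1 - p.2|%:E.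
Proof.
move=> cmu cnu plang.
have [|p /set_mem sp pmax] := compact_EVT_max (f := fun p => `|p.1 - p.2|)
    (plan_spt_neq0 plang) (plan_spt_compact cmu cnu plang).
  by apply: continuous_subspaceT; exact: continuous_cost.
exists p => //; apply/eqP; rewrite eq_le; apply/andP; split.
  by apply: max_cost_le_spt => q /mem_set; exact: pmax.
rewrite leNgt; apply/negP.
case: (max_cost g) (@spt_cost_le g ^~ p) => [r| |] gle; rewrite ?ltNge ?leey//.
  by rewrite lee_fin (gle r).
(* A cost of [-oo] would bound the displacement at [p] by itself minus one. *)
by have := gle (`|p.1 - p.2| - 1) (leNye _) sp; rewrite lerDl oppr_ge0 ler10.
Qed.

(** The case [n = 1], where [ordS] exchanges the two indices. *)
Lemma icm_pair {mu nu g p q} : infty_cyclically_monotone mu nu g ->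
  spt g p -> spt g q ->
  Num.max `|p.1 - p.2| `|q.1 - q.2| <= Num.max `|p.1 - q.2| `|q.1 - p.2|.
Proof.
move=> [_ icm] sp sq.
have := icm 1%N (fun i => if i == ord0 then p else q).
rewrite !big_ord_recl !big_ord0 /= !(max_l (normr_ge0 _)).
by apply=> i; case: ifP.
Qed.

(** A crossing gives [y' - x < y - x = L] and [x - y' < x' - y' <= L], and likewise for [y - x'], so
    both exchanged displacements are below [L]. *)
Lemma no_crossing (x y x' y' L : R) :
  y = x + L -> `|x' - y'| <= L -> L <= Num.max `|x - y'| `|x' - y| ->
  ~ (x < x' /\ y' < y).
Proof.
move=> -> /[!ler_norml] /andP[h1 h2] + [h3 h4].
by rewrite le_max !ler_normr => /orP[]/orP[]; lra.
Qed.

(** By [corner_transfer], a box around [p] that is null for [h] would be null for [g]. The bound [L]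
    is arbitrary, not [lambdaC], so that the lemma can also serve to prove optimality. *)
Lemma icm_spt_sub mu nu g h (L : R) p : atomless mu -> atomless nu ->
  infty_cyclically_monotone mu nu g -> transport_plan mu nu h ->
  (max_cost g <= L%:E)%E -> (max_cost h <= L%:E)%E ->
  `|p.1 - p.2| = L -> spt g p -> spt h p.
Proof.
move=> amu anu icm planh gL hL pL sp U oU Up.
have plang : transport_plan mu nu g by case: icm.
have law1 A : measurable A -> g (fst @^-1` A) = h (fst @^-1` A).
  by move=> mA; rewrite [LHS](plang A mA).1 [RHS](planh A mA).1.
have law2 A : measurable A -> g (snd @^-1` A) = h (snd @^-1` A).
  by move=> mA; rewrite [LHS](plang A mA).2 [RHS](planh A mA).2.
have atom1 x : g (fst @^-1` [set x]) = 0%E.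
  by rewrite [LHS](plang _ (measurable_set1 x)).1.
have atom2 x : g (snd @^-1` [set x]) = 0%E.
  by rewrite [LHS](plang _ (measurable_set1 x)).2.
have gfin : (g setT < +oo)%E by rewrite (plan_setT plang) ltry.
have m1 : measurable_fun setT (@fst R R) by exact: measurable_fst.
have m2 : measurable_fun setT (@snd R R) by exact: measurable_snd.
rewrite lt0e measure_ge0 andbT; apply/eqP => hU.
have /nbhs_ballP[e /= e0 eU] : nbhs p U by rewrite nbhsE /=; exists U.
have hbox : h.-negligible (ball p e).
  by apply: negligibleS eU _; apply/negligibleP => //; exact: open_measurable_plane.
apply: (spt_not_negligible g (ball p e) p) => //.
- exact: ball_open.
- exact: ballxx.
have max_pair q : spt g q -> L <= Num.max `|p.1 - q.2| `|q.1 - p.2|.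
  by move=> /(icm_pair icm sp); rewrite ge_max pL => /andP[].
have max_costLP := fun m => (max_cost_leP m L).1.
have gN := negligible_sptC g.
have [p12|p12] := leP p.1 p.2.
- have p2E : p.2 = p.1 + L by rewrite -pL distrC ger0_norm ?subr_ge0// addrC subrK.
  have := @corner_transfer _ _ R g h fst snd m1 m2 law1 law2 gfin p.1 L
    (atom1 _) (atom2 _) _ _ _ e.
  rewrite -p2E; apply => //.
  + apply: negligibleS (max_costLP _ gL) => q /= qL.
    by rewrite distrC ltr_normr; apply/orP; left; lra.
  + apply: negligibleS (max_costLP _ hL) => q /= qL.
    by rewrite distrC ltr_normr; apply/orP; left; lra.
  + apply: negligibleS gN => q /= qp sq; move: qp.
    exact: no_crossing p2E (spt_cost_le _ _ _ gL sq) (max_pair q sq).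
(* A displacement to the left is one to the right once the coordinates and the marginals are
   exchanged. *)
- have p1E : p.1 = p.2 + L by rewrite -pL gtr0_norm ?subr_gt0// addrC subrK.
  have := @corner_transfer _ _ R g h snd fst m2 m1 law2 law1 gfin p.2 L
    (atom2 _) (atom1 _) _ _ _ e.
  rewrite -p1E setIC; apply => //.
  + apply: negligibleS (max_costLP _ gL) => q /= qL.
    by rewrite ltr_normr; apply/orP; left; lra.
  + apply: negligibleS (max_costLP _ hL) => q /= qL.
    by rewrite ltr_normr; apply/orP; left; lra.
  + apply: negligibleS gN => q /= qp sq; move: qp.
    apply: no_crossing p1E _ _; first by rewrite distrC; exact: spt_cost_le gL sq.
    by rewrite distrC [`|q.2 - _|]distrC maxC; exact: max_pair.
Qed.

(** * Optimality and maximal displacement sets *)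

Section optimality.
Context {mu nu : probability R R}.
Hypothesis compact_mu : compact (spt mu).
Hypothesis compact_nu : compact (spt nu).
Hypothesis atomless_mu : atomless mu.
Hypothesis atomless_nu : atomless nu.

(* If some plan had a smaller cost, [icm_spt_sub] would put a longest
   displacement of the cyclically monotone plan into its support. *)
Lemma icm_optimal g : infty_cyclically_monotone mu nu g -> optimal_plan mu nu g.
Proof.
move=> icm; have plang : transport_plan mu nu g by case: icm.
split=> //; apply/eqP; rewrite eq_le; apply/andP; split; last first.
  by apply: ereal_inf_lbound; exists g.
apply: le_ereal_inf_tmp => _ [h planh <-].
have [p sp gp] := plan_max_cost compact_mu compact_nu plang.
have [q sq hq] := plan_max_cost compact_mu compact_nu planh.
rewrite leNgt; apply/negP => hg.
have sph : spt h p.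
  apply: (icm_spt_sub _ _ _ _ `|p.1 - p.2| p atomless_mu atomless_nu icm) => //.
  - by rewrite gp.
  - by rewrite ltW// -gp.
have := spt_cost_le h `|q.1 - q.2| p _ sph.
by rewrite hq => /(_ (lexx _)); rewrite leNgt -lte_fin -gp -hq hg.
Qed.

(** The cost is attained on the support, hence real, so [fine] loses nothing. *)
Lemma optimal_max_cost g : optimal_plan mu nu g ->
  max_cost g = (lambdaC mu nu)%:E.
Proof.
move=> [plang gW]; rewrite /lambdaC -gW.
by have [p _ ->] := plan_max_cost compact_mu compact_nu plang.
Qed.

Lemma lambdaC_ge0 g : optimal_plan mu nu g -> 0 <= lambdaC mu nu.
Proof.
move=> optg; rewrite -lee_fin -(optimal_max_cost _ optg).
have [p _ ->] := plan_max_cost compact_mu compact_nu optg.1.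
by rewrite lee_fin.
Qed.

(** The points [(x, x + lambdaC)] and [(x, x - lambdaC)] have displacement exactly [lambdaC], the
    common cost of optimal plans, so [icm_spt_sub] applies with this bound. *)
Lemma icm_maximal_displacement g h :
  optimal_plan mu nu h -> infty_cyclically_monotone mu nu g ->
  Mplus mu nu g `<=` Mplus mu nu h /\ Mminus mu nu g `<=` Mminus mu nu h.
Proof.
move=> opth icm; have optg := icm_optimal _ icm.
have costE k : optimal_plan mu nu k -> (max_cost k <= (lambdaC mu nu)%:E)%E.
  by move=> /optimal_max_cost ->.
have sub p : `|p.1 - p.2| = lambdaC mu nu -> spt g p -> spt h p.
  by apply: icm_spt_sub icm _ _ _ => //; [case: opth|exact: costE|exact: costE].
have l0 := lambdaC_ge0 _ opth.
split=> x; apply: sub => /=.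
  by rewrite opprD addrA subrr add0r normrN ger0_norm.
by rewrite opprB addrC subrK ger0_norm.
Qed.

(** A closed set, as a continuous preimage of the support, inside the compact [spt mu]; [t] stands
    for both signs of [lambdaC]. *)
Lemma compact_displacement g (t : R) : transport_plan mu nu g ->
  compact [set x | spt g (x, x + t)].
Proof.
move=> plang; apply: (subclosed_compact _ compact_mu).
  apply: (@preimage_closed _ _ (fun x : R => (x, x + t)) (spt g) _ (closed_spt g)).
  move=> x _; apply: (@cvg_pair _ _ _ (nbhs x) (nbhs x) (nbhs (x + t))); first exact: cvg_id.
  by apply: cvgD; [exact: cvg_id|exact: cvg_cst].
by move=> x /(plan_spt_sub plang)[].
Qed.

End optimality.
End transport_plans.

Theorem theorem4p2 (R : realType) (mu nu : probability R R)
    (compact_mu : compact (spt mu)) (compact_nu : compact (spt nu))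
    (atomless_mu : atomless mu) (atomless_nu : atomless nu) :
  (forall gamma gammabar : {measure set (R * R)%type -> \bar R},
     optimal_plan mu nu gamma -> optimal_plan mu nu gammabar ->
     infty_cyclically_monotone mu nu gammabar ->
     Mplus mu nu gammabar `<=` Mplus mu nu gamma /\
     Mminus mu nu gammabar `<=` Mminus mu nu gamma) /\
  (exists Mp Mm : set R,
     [/\ compact Mp, compact Mm &
      forall gamma : {measure set (R * R)%type -> \bar R}, optimal_plan mu nu gamma ->
        [/\ Mp `<=` Mplus mu nu gamma, Mm `<=` Mminus mu nu gamma &
         infty_cyclically_monotone mu nu gamma ->
           Mplus mu nu gamma = Mp /\ Mminus mu nu gamma = Mm]]) /\
  (forall gamma1 gamma2 : {measure set (R * R)%type -> \bar R},
     infty_cyclically_monotone mu nu gamma1 ->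
     infty_cyclically_monotone mu nu gamma2 ->
     Mset mu nu gamma1 = Mset mu nu gamma2).
Proof.
have icm_sub := @icm_maximal_displacement R mu nu compact_mu compact_nu
  atomless_mu atomless_nu.
have icm_opt := @icm_optimal R mu nu compact_mu compact_nu
  atomless_mu atomless_nu.
(* Both plans are optimal, so the inclusion holds in both directions. *)
have icm_eq g h : infty_cyclically_monotone mu nu g ->
    infty_cyclically_monotone mu nu h ->
    Mplus mu nu g = Mplus mu nu h /\ Mminus mu nu g = Mminus mu nu h.
  move=> icmg icmh.
  have [gp gm] := icm_sub _ _ (icm_opt _ icmh) icmg.
  have [hp hm] := icm_sub _ _ (icm_opt _ icmg) icmh.
  by split; apply/seteqP.
split; last split.
- by move=> g gbar optg _; exact: icm_sub.
- have [[g icmg]|no_icm] := pselect (exists g, infty_cyclically_monotone mu nu g).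
  + have plang := icmg.1.
    exists (Mplus mu nu g), (Mminus mu nu g); split.
    * exact: compact_displacement plang.
    * exact: compact_displacement plang.
    * move=> h opth; have [hp hm] := icm_sub _ _ opth icmg.
      by split => // icmh; exact: icm_eq.
  (* Without a cyclically monotone plan, the equality clause is vacuous and empty sets satisfy the
     inclusions. *)
  + exists set0, set0; split; [exact: compact0|exact: compact0|].
    move=> h _; split; [exact: sub0set|exact: sub0set|].
    by move=> icmh; case: no_icm; exists h.
- by move=> g h icmg icmh; rewrite /Mset; have [-> ->] := icm_eq _ _ icmg icmh.
Qed.
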